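(* For $n\ge2$, let $\mathcal{O}_n=\{x\in\mathbb{R}^n: 1\ge x_1\ge x_2\ge\cdots\ge x_n\ge0\}$, let $\Pi$ be the brick $I_{p_1}\times I_{p_2}\times\cdots\times I_{p_{n-1}}\times I_{1/\sqrt n}$ with $p_i:=1/\sqrt{i(i+1)}$, and let $\Theta:\mathcal{O}_n\to\Pi$ be the map associated with the recursive dissection of $\mathcal{O}_n$ into $\Pi$ (defined in the context). Then, given $x\in\mathcal{O}_n$, the point $\Theta(x)\in\Pi$ can be computed in $O(n^2)$ steps.
   Context: A ''step'' is one elementary operation on real numbers (addition, subtraction, multiplication, division, square root, floor, comparison, or copying); the constant in $O(n^2)$ is absolute. $I_\ell$ is the interval $[0,\ell]$. Standard simplices. For $k\ge2$ and $-1<w<\frac1{k-1}$ (and for $k=1$, $w=1$) put $b:=(\sqrt{1-w(k-1)}-\sqrt{1+w})/k$, $a:=b+\sqrt{1+w}$, and let $v_i\in\mathbb{R}^k$ be the vector with $i$-th coordinate $a$ and all others $b$. The standard $\mathcal{Q}_k(w)$ is the convex hull of $0,v_1,v_1+v_2,\dots,v_1+\cdots+v_k$. Then $\mathcal{Q}_n(0)=\mathcal{O}_n$, and $\mathcal{P}_k:=\mathcal{Q}_k(\frac1k)$; for $k=1$ this is $\mathcal{P}_1=[0,1]$. Matrices. $M_k$ is the $k\times k$ orthogonal matrix whose $i$-th column, for $1\le i\le k-1$, has entries $p_i$ ($i$ times), then $-ip_i$ (once), then $0$ ($k-i-1$ times), and whose last column has all entries $1/\sqrt k$ (so $M_1=[1]$).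 For $k\ge2$, $N_k$ is the $k\times(k-1)$ matrix equal to ($M_k$ with its last column deleted) times $M_{k-1}^{\mathrm{tr}}$. Vectors are row vectors. One stage. For $k\ge2$ and $-1<w<\frac1{k-1}$, with $b=(\sqrt{1-w(k-1)}-\sqrt{1+w})/k$ and $a=b+\sqrt{1+w}$, let $h:=\sqrt{1-w(k-1)}$ and $\phi(x_1,\dots,x_k):=(x_k+a,x_1+b,x_2+b,\dots,x_{k-1}+b)$. For $x\in\mathcal{Q}_k(w)$ let $s:=\sum_i x_i$, $r:=\lfloor s/h\rfloor$, $x':=\phi^{-r}(x)$, and define $$F_{k,w}(x):=\Bigl(x'N_k,\ \tfrac{1}{\sqrt k}\sum_i x_i'\Bigr)\in\mathbb{R}^{k-1}\times\mathbb{R}.$$ This piecewise isometry realizes the dissection of $\mathcal{Q}_k(w)$ into the prism $\sqrt{(k-1)(w+1)/k}\;\mathcal{P}_{k-1}\times I_{h/\sqrt k}$. The map $\Theta$. Put $\lambda_k:=\sqrt{k/(k+1)}$. Given $x\in\mathcal{O}_n$, let $(z^{(n-1)},y_n):=F_{n,0}(x)$, where $z^{(n-1)}\in\lambda_{n-1}\mathcal{P}_{n-1}$. For $k=n-1,n-2,\dots,2$ in turn, given $z^{(k)}\in\lambda_k\mathcal{P}_k$, let $(z^{(k-1)},y_k):=\lambda_k\,F_{k,1/k}(z^{(k)}/\lambda_k)$, where $z^{(k-1)}\in\lambda_{k-1}\mathcal{P}_{k-1}$. Finally let $y_1:=z^{(1)}\in\lambda_1\mathcal{P}_1=[0,p_1]$.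 Then $\Theta(x):=(y_1,\dots,y_n)$. *)

(* Defs.v *)
From mathcomp Require Import all_boot all_order all_algebra.
From mathcomp Require Import reals.

Set Implicit Arguments.
Unset Strict Implicit.
Unset Printing Implicit Defensive.
Import Order.TTheory GRing.Theory Num.Theory.
Local Open Scope ring_scope.

(* Coordinates and matrix indices are 0-based: the mathematical x_i is
   [x 0 (i-1)]. *)

Definition pside {R : realType} (i : nat) : R :=
  (Num.sqrt (i * i.+1)%:R)^-1.

Definition in_O {R : realType} (n : nat) (x : 'rV[R]_n) : Prop :=
  (forall i, 0 <= x 0 i <= 1) /\
  (forall i j : 'I_n, (i <= j)%N -> x 0 j <= x 0 i).

Definition brick_side {R : realType} (n : nat) (i : 'I_n) : R :=
  if i.+1 == n then (Num.sqrt n%:R)^-1 else pside i.+1.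

Definition in_brick {R : realType} (n : nat) (y : 'rV[R]_n) : Prop :=
  forall i, 0 <= y 0 i <= brick_side i.

Definition Mmx {R : realType} (k : nat) : 'M[R]_k :=
  \matrix_(i, j)
    if j.+1 == k then (Num.sqrt k%:R)^-1
    else if (i <= j)%N then pside j.+1
    else if (i == j.+1 :> nat) then - (j.+1%:R * pside j.+1)
    else 0.

(* [Nmx m] is N_k for k = m + 1. *)
Definition Nmx {R : realType} (m : nat) : 'M[R]_(m.+1, m) :=
  col' ord_max (Mmx m.+1) *m (Mmx m)^T.

(* The length called h; the indices satisfy k >= 1, so that k.-1 = k - 1. *)
Definition hlen {R : realType} (k : nat) (w : R) : R :=
  Num.sqrt (1 - w * k.-1%:R).

Definition bcoef {R : realType} (k : nat) (w : R) : R :=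
  (hlen k w - Num.sqrt (1 + w)) / k%:R.

Definition acoef {R : realType} (k : nat) (w : R) : R :=
  bcoef k w + Num.sqrt (1 + w).

(* [ord_pred] is the cyclic predecessor, so coordinate 0 receives the last
   coordinate of x plus a. *)
Definition phi {R : realType} (k : nat) (w : R) (x : 'rV[R]_k) : 'rV[R]_k :=
  \row_i (x 0 (ord_pred i) +
          (if (i == 0%N :> nat) then acoef k w else bcoef k w)).

Definition phi_inv {R : realType} (k : nat) (w : R) (x : 'rV[R]_k) : 'rV[R]_k :=
  \row_i (x 0 (ordS i) -
          (if (ordS i == 0%N :> nat) then acoef k w else bcoef k w)).

Lemma phiK {R : realType} (k : nat) (w : R) :
  cancel (@phi R k w) (phi_inv w).
Proof. by move=> x; apply/rowP => i; rewrite !mxE ordSK addrK. Qed.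

Lemma phi_invK {R : realType} (k : nat) (w : R) :
  cancel (@phi_inv R k w) (phi w).
Proof. by move=> x; apply/rowP => i; rewrite !mxE ord_predK subrK. Qed.

(* phi to the power -r, for an integer r of any sign. *)
Definition phi_expN {R : realType} (k : nat) (w : R) (r : int)
    (x : 'rV[R]_k) : 'rV[R]_k :=
  match r with
  | Posz q => iter q (phi_inv w) x
  | Negz q => iter q.+1 (phi w) x
  end.

(* The map F_{k,w} for k = m + 1, its defining formula being extended to all
   of R^k. *)
Definition stage {R : realType} (m : nat) (w : R) (x : 'rV[R]_m.+1) :
    'rV[R]_m * R :=
  let s := \sum_i x 0 i in
  let r := Num.floor (s / hlen m.+1 w) in
  let x' := phi_expN w r x in
  (x' *m Nmx m, (Num.sqrt m.+1%:R)^-1 * \sum_i x' 0 i).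

Definition lambda {R : realType} (k : nat) : R := Num.sqrt (k%:R / k.+1%:R).

Definition append_coord {R : realType} (m : nat) (u : 'rV[R]_m) (c : R) :
    'rV[R]_m.+1 :=
  \row_i (if unlift ord_max i is Some j then u 0 j else c).

(* Maps z^{(k)} to (y_1, ..., y_k), for k = m + 1. *)
Fixpoint Theta_from {R : realType} (m : nat) : 'rV[R]_m.+1 -> 'rV[R]_m.+1 :=
  match m with
  | 0 => fun z => z
  | m'.+1 => fun z =>
      let k := m'.+2 in
      let zy := stage (k%:R^-1) ((lambda k)^-1 *: z) in
      append_coord (Theta_from (lambda k *: zy.1)) (lambda k * zy.2)
  end.

(* Only meaningful for n >= 2; it is the identity for n < 2. *)
Definition Theta {R : realType} (n : nat) : 'rV[R]_n -> 'rV[R]_n :=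
  match n with
  | m.+2 => fun x => let zy := stage 0 x in append_coord (Theta_from zy.1) zy.2
  | _ => fun x => x
  end.

(* A real random access machine. A state consists of real registers, named
   by the program, and a real memory, addressed indirectly through registers
   holding natural numbers. A program is a finite piece of syntax containing
   no real number other than natural constants, and is therefore independent
   of the dimension and of the input. Index arithmetic is done on real
   registers and is counted like any other arithmetic. *)
Inductive prog : Type :=
| Skip
| Seq (p q : prog)
| Const (d c : nat)       (* reg d := c, a natural number constant *)
| Copy (d a : nat)        (* reg d := reg a *)
| Fetch (d a : nat)        (* reg d := mem (reg a) *)
| Put (a b : nat)       (* mem (reg a) := reg b *)
| Add (d a b : nat)       (* reg d := reg a + reg b, and likewise below *)
| Sub (d a b : nat)
| Mul (d a b : nat)
| Div (d a b : nat)
| Sqrt (d a : nat)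
| Floor (d a : nat)
| IfLt (a b : nat) (p q : prog)     (* if reg a < reg b then p else q *)
| WhileLt (a b : nat) (p : prog).   (* while reg a < reg b do p *)

Record state (R : realType) := State { reg : nat -> R; mem : nat -> R }.

Definition upd {R : realType} (f : nat -> R) (i : nat) (v : R) : nat -> R :=
  fun j => if j == i then v else f j.

Definition set_reg {R : realType} (s : state R) (d : nat) (v : R) : state R :=
  State (upd (reg s) d v) (mem s).

Definition set_mem {R : realType} (s : state R) (i : nat) (v : R) : state R :=
  State (reg s) (upd (mem s) i v).

(* [exec p s t s'] : started in s, the program p halts in s' after exactly t
   steps. Division by zero, the square root of a negative number, and an
   address that is not a natural number have no rule, so that a program
   performing one of them does not halt successfully. *)
Inductive exec {R : realType} : prog -> state R -> nat -> state R -> Prop :=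
| exec_skip s : exec Skip s 0 s
| exec_seq p q s t s1 u s2 :
    exec p s t s1 -> exec q s1 u s2 -> exec (Seq p q) s (t + u) s2
| exec_const d c s : exec (Const d c) s 1 (set_reg s d c%:R)
| exec_copy d a s : exec (Copy d a) s 1 (set_reg s d (reg s a))
| exec_fetch d a i s :
    reg s a = i%:R -> exec (Fetch d a) s 1 (set_reg s d (mem s i))
| exec_put a b i s :
    reg s a = i%:R -> exec (Put a b) s 1 (set_mem s i (reg s b))
| exec_add d a b s : exec (Add d a b) s 1 (set_reg s d (reg s a + reg s b))
| exec_sub d a b s : exec (Sub d a b) s 1 (set_reg s d (reg s a - reg s b))
| exec_mul d a b s : exec (Mul d a b) s 1 (set_reg s d (reg s a * reg s b))
| exec_div d a b s :
    reg s b != 0 -> exec (Div d a b) s 1 (set_reg s d (reg s a / reg s b))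
| exec_sqrt d a s :
    0 <= reg s a -> exec (Sqrt d a) s 1 (set_reg s d (Num.sqrt (reg s a)))
| exec_floor d a s :
    exec (Floor d a) s 1 (set_reg s d (Num.floor (reg s a))%:~R)
| exec_if_true a b p q s t s' :
    reg s a < reg s b -> exec p s t s' -> exec (IfLt a b p q) s t.+1 s'
| exec_if_false a b p q s t s' :
    ~~ (reg s a < reg s b) -> exec q s t s' -> exec (IfLt a b p q) s t.+1 s'
| exec_while_true a b p s t s1 u s2 :
    reg s a < reg s b -> exec p s t s1 -> exec (WhileLt a b p) s1 u s2 ->
    exec (WhileLt a b p) s (t + u).+1 s2
| exec_while_false a b p s :
    ~~ (reg s a < reg s b) -> exec (WhileLt a b p) s 1 s.

(* Register 0 holds n and memory cells 0, ..., n-1 hold the coordinates of x;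
   everything else is 0. *)
Definition input {R : realType} (n : nat) (x : 'rV[R]_n) : state R :=
  State (fun d => if d == 0%N then n%:R else 0)
        (fun j => if insub j is Some i then x 0 i else 0).

Definition computes_within {R : realType} (p : prog) (n : nat)
    (x y : 'rV[R]_n) (T : nat) : Prop :=
  exists (t : nat) (s : state R),
    [/\ exec p (input x) t s, (t <= T)%N & forall i : 'I_n, mem s i = y 0 i].

(* Main.v *)
(* In the coordinates c of x with respect to v_1, ..., v_k every Q_k(w) becomes
   the simplex 1 >= c_1 >= ... >= c_k >= 0, sum x_i = h * sum c_i, and phi becomes
   (c_1, ..., c_k) |-> (c_k + 1, c_1, ..., c_(k-1)), whatever w is. Since
   N_k(i, j) = delta_ij + const for i < k while the last row of N_k is constant,
   F_{k,w} is, up to scaling, c |-> (c'_1 - c'_k, ..., c'_(k-1) - c'_k; frac(sum c_i))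
   with c' the image of c under phi^(-r); and the differences again lie in the
   simplex one dimension lower. So Theta only alternates cyclic shifts by
   r = floor(sum c_i) with subtractions of the last coordinate, and each stage
   takes O(k) steps. *)
Require Import Defs.
From mathcomp Require Import all_boot all_order all_algebra.
From mathcomp Require Import reals.
From mathcomp Require Import zify ring lra.

Import Defs.

Set Implicit Arguments.
Unset Strict Implicit.
Unset Printing Implicit Defensive.
Import Order.TTheory GRing.Theory Num.Theory.
Local Open Scope ring_scope.

Section Geometry.
Variable R : realType.
Implicit Types (c : nat -> R) (w : R).

(** * Entries of the matrices N_k *)

Lemma sqrtM_nat (m n : nat) :
  Num.sqrt (m * n)%:R = Num.sqrt m%:R * Num.sqrt n%:R :> R.
Proof. by rewrite natrM sqrtrM. Qed.

Lemma sqrt_nat_gt0 (n : nat) : 0 < Num.sqrt n.+1%:R :> R.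
Proof. by rewrite sqrtr_gt0 ltr0n. Qed.

Lemma sqrt_nat_neq0 (n : nat) : Num.sqrt n.+1%:R != 0 :> R.
Proof. exact: lt0r_neq0 (sqrt_nat_gt0 n). Qed.

Lemma pside_sqr (k : nat) : pside k.+1 ^+ 2 = (k.+1%:R * k.+2%:R)^-1 :> R.
Proof. by rewrite /pside exprVn sqr_sqrtr ?ler0n // natrM. Qed.

(* The columns of M_k but the last do not depend on k, apart from the number of
   their entries. *)
Definition Mcol (i j : nat) : R :=
  if (i <= j)%N then pside j.+1
  else if i == j.+1 then - (j.+1%:R * pside j.+1) else 0.

Lemma Mcol_far i j : (j.+1 < i)%N -> Mcol i j = 0.
Proof. by move=> ji; rewrite /Mcol leqNgt ltnW //= gtn_eqF. Qed.

Lemma Mcol_sum_last k (f : nat -> R) :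
  \sum_(j < k) Mcol k j * f j = if k is j.+1 then - (k%:R * pside k) * f j else 0.
Proof.
case: k => [|k]; first by rewrite big_ord0.
rewrite big_ord_recr big1 /= => [|j _].
  by rewrite add0r /Mcol ltnn eqxx.
by rewrite Mcol_far ?mul0r // ltnS ltn_ord.
Qed.

(** The rows of the orthogonal matrix M_(k+1) are orthonormal, and omitting its last column, with
    entries 1 / sqrt (k+1), takes 1 / (k+1) off every inner product. In the induction the added
    column contributes 1 / ((k+1)(k+2)) to the old rows, which telescopes; the new row has a single
    nonzero entry. *)
Lemma Mcol_dot k (i i' : nat) : (i <= k)%N -> (i' <= k)%N ->
  \sum_(j < k) Mcol i j * Mcol i' j = (i == i')%:R - k.+1%:R^-1.
Proof.
elim: k i i' => [|k IH] i i'.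
  by rewrite !leqn0 => /eqP-> /eqP->; rewrite big_ord0 invr1 subrr.
have k1 : k.+1%:R != 0 :> R by rewrite pnatr_eq0.
have k2 : k.+1%:R + 1 != 0 :> R by rewrite natr1 pnatr_eq0.
have E : pside k.+1 ^+ 2 = (k.+1%:R * (k.+1%:R + 1))^-1 :> R by rewrite natr1 pside_sqr.
rewrite -[k.+2%:R]natr1.
have lastE (j : nat) : (j <= k.+1)%N ->
    \sum_(l < k.+1) Mcol k.+1 l * Mcol j l = (k.+1 == j)%:R - (k.+1%:R + 1)^-1.
  rewrite Mcol_sum_last /Mcol; have [<- _|nj jk] := eqVneq k.+1 j.
    rewrite ltnn mulr1n; transitivity (k.+1%:R ^+ 2 * pside k.+1 ^+ 2 : R); first ring.
    by rewrite E; move: (k.+1%:R) k1 k2 => K k1 k2; field; rewrite k1 k2.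
  move: jk; rewrite leq_eqVlt eq_sym (negPf nj) ltnS => /= ->.
  rewrite mulNr -mulrA -expr2 E sub0r.
  by move: (k.+1%:R) k1 k2 => K k1 k2; field; rewrite k1 k2.
move=> ik ik'.
have [->|ni] := eqVneq i k.+1; first exact: lastE.
have [->|ni'] := eqVneq i' k.+1.
  by rewrite eq_sym -lastE //; apply: eq_bigr => j _; rewrite mulrC.
have {ik ni} ik : (i <= k)%N by lia.
have {ik' ni'} ik' : (i' <= k)%N by lia.
rewrite big_ord_recr /= IH // /Mcol ik ik' -expr2 E.
by move: (k.+1%:R) k1 k2 => K k1 k2; field; rewrite k1 k2.
Qed.

Lemma Nmx_sum m (i : 'I_m.+2) (j : 'I_m.+1) :
  Nmx m.+1 i j =
    \sum_(l < m) Mcol i l * Mcol j l + Mcol i m / Num.sqrt m.+1%:R :> R.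
Proof.
have E (l : 'I_m.+1) : Mmx m.+2 i (lift ord_max l) = Mcol i l :> R.
  by rewrite mxE lift_max eqSS ltn_eqF.
rewrite mxE big_ord_recr /=; congr (_ + _).
  apply: eq_bigr => l _; rewrite mxE E; congr (_ * _).
  by rewrite 2!mxE /= eqSS ltn_eqF.
by rewrite mxE E 2!mxE /= eqxx.
Qed.

(** The constant added to the identity matrix in the first m rows of N_(m+1). By [lambda_bcoef] it
    is also the coefficient b of lambda_m P_m, which makes consecutive stages fit together. *)
Definition ncoef (m : nat) : R := ((Num.sqrt m.+1%:R)^-1 - 1) / m%:R.

Lemma NmxE m (i j : 'I_m.+1) :
  Nmx m.+1 (widen_ord (leqnSn _) i) j = (i == j)%:R + ncoef m.+1 :> R.
Proof.
rewrite Nmx_sum /= Mcol_dot ?leq_ord // /Mcol leq_ord /ncoef /pside sqrtM_nat.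
have u0 := sqrt_nat_neq0 m; have v0 := sqrt_nat_neq0 m.+1.
have : Num.sqrt m.+1%:R ^+ 2 = m.+1%:R :> R by rewrite sqr_sqrtr ?ler0n.
set u := Num.sqrt m.+1%:R in u0 *; set v := Num.sqrt m.+2%:R in v0 *.
by move=> <-; field; rewrite u0 v0.
Qed.

Lemma NmxE_last m (j : 'I_m.+1) :
  Nmx m.+1 ord_max j = - (Num.sqrt m.+2%:R)^-1 :> R.
Proof.
rewrite Nmx_sum big1 ?add0r => [|l _]; last first.
  by rewrite Mcol_far ?mul0r //= ltnS ltn_ord.
rewrite /Mcol /= ltnn eqxx /pside sqrtM_nat.
have u0 := sqrt_nat_neq0 m; have v0 := sqrt_nat_neq0 m.+1.
have : Num.sqrt m.+1%:R ^+ 2 = m.+1%:R :> R by rewrite sqr_sqrtr ?ler0n.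
set u := Num.sqrt m.+1%:R in u0 *; set v := Num.sqrt m.+2%:R in v0 *.
by move=> <-; field; rewrite u0 v0.
Qed.

(** * Simplex coordinates and the action of phi on them *)

Definition csum k c : R := \sum_(i < k) c i.

(* The point c_1 v_1 + ... + c_k v_k, for the vectors v_i of Q_k(w). *)
Definition Qpoint k w c : 'rV[R]_k :=
  \row_i (bcoef k w * csum k c + Num.sqrt (1 + w) * c i).

(* The continuation of c that makes phi^(-r) a shift by r, for 0 <= r <= k. *)
Definition extend k c (j : nat) : R := if (j < k)%N then c j else c (j - k)%N - 1.

Definition turns k c : nat := Num.truncn (csum k c).

(* The coordinates of z^(k-1), where c holds those of z^(k). *)
Definition descend k c (i : nat) : R :=
  extend k c (i + turns k c) - extend k c (k.-1 + turns k c).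

Definition in_simplex k c : Prop :=
  (forall i, (i < k)%N -> 0 <= c i <= 1) /\
  (forall i j, (i <= j)%N -> (j < k)%N -> c j <= c i).

(** The effect of phi^(-1) on coordinates: a left shift in which the entry that wraps round loses 1.
    Being a relation, it leaves the values from index k on free. *)
Definition rotated k c c' : Prop :=
  (forall i, (i.+1 < k)%N -> c' i = c i.+1) /\ c' k.-1 = c 0%N - 1.

Lemma csum_rotated k c c' : (0 < k)%N -> rotated k c c' -> csum k c' = csum k c - 1.
Proof.
case: k => // k _ [cE cL]; rewrite /csum big_ord_recr big_ord_recl /= cL.
rewrite (eq_bigr (fun i : 'I_k => c i.+1)) => [|j _]; last first.
  by rewrite cE // ltnS ltn_ord.
by rewrite addrC addrAC.
Qed.

(** The coordinate sum drops by 1, so the common summand drops by b, as [phi_inv] demands; the entry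
    that wraps round loses a - b = sqrt (1 + w) in addition. *)
Lemma phi_inv_Qpoint k w c c' :
  rotated k c c' -> phi_inv w (Qpoint k w c) = Qpoint k w c'.
Proof.
case: k => [|k] cc'; apply/rowP => i; first by case: i.
have [cE cL] := cc'; rewrite !mxE (csum_rotated _ cc') // /acoef.
case: (ltnP i k) => ik.
  have -> : ordS i = i.+1 :> nat by rewrite /= modn_small.
  by rewrite cE //=; ring.
have iE : i = k :> nat by apply/eqP; rewrite eqn_leq ik -ltnS ltn_ord.
have -> : ordS i = 0%N :> nat by rewrite /= iE modnn.
by rewrite iE cL /=; ring.
Qed.

Lemma extend_rotated k c r : (r < k)%N ->
  rotated k (fun i => extend k c (i + r)) (fun i => extend k c (i + r.+1)).
Proof.
move=> rk; split=> [i ik|]; first by rewrite addSnnS.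
rewrite /extend add0n rk ifF; last by apply/negbTE; rewrite -leqNgt; lia.
by congr (c _ - 1); lia.
Qed.

Lemma extend0 k c (i : 'I_k) : extend k c (i + 0) = c i.
Proof. by rewrite /extend addn0 ltn_ord. Qed.

Lemma iter_phi_inv_Qpoint k w c r : (r <= k)%N ->
  iter r (phi_inv w) (Qpoint k w c) = Qpoint k w (fun i => extend k c (i + r)).
Proof.
elim: r => [_|r IH rk].
  apply/rowP => i; rewrite !mxE /csum extend0.
  by under [in RHS]eq_bigr => j _ do rewrite extend0.
rewrite iterS IH; last exact: ltnW.
by apply: phi_inv_Qpoint; exact: extend_rotated.
Qed.

Lemma csum_extend k c r : (r <= k)%N ->
  csum k (fun i => extend k c (i + r)) = csum k c - r%:R.
Proof.
elim: r => [_|r IH rk]; first by rewrite subr0; apply: eq_bigr => i _; rewrite extend0.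
rewrite (csum_rotated _ (extend_rotated c rk)) ?(leq_trans _ rk) // IH 1?ltnW //.
by rewrite -natr1; ring.
Qed.

Lemma sum_Qpoint k w c : \sum_i Qpoint k.+1 w c 0 i = hlen k.+1 w * csum k.+1 c.
Proof.
under eq_bigr do rewrite mxE.
rewrite big_split sumr_const card_ord -mulr_sumr -/(csum _ _) /bcoef.
by rewrite /= -mulr_natr; field; rewrite nat1r pnatr_eq0.
Qed.

Lemma csum_bounds k c : in_simplex k c -> 0 <= csum k c <= k%:R.
Proof.
move=> [cb _]; apply/andP; split.
  by apply: sumr_ge0 => i _; case/andP: (cb i (ltn_ord i)).
rewrite -[k in k%:R]card_ord -sumr_const; apply: ler_sum => i _.
by case/andP: (cb i (ltn_ord i)).
Qed.

Lemma floor_csum k c : in_simplex k c -> Num.floor (csum k c) = turns k c.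
Proof.
move=> /csum_bounds/andP[c0 _]; apply: floor_def.
by rewrite intrD natr1; exact: truncn_itv.
Qed.

(** Since r = k is possible (all coordinates equal to 1), the windows of length k in [extend] reach
    up to index 2k - 1. *)
Lemma turns_bounds k c : in_simplex k c ->
  (turns k c <= k)%N /\ 0 <= csum k c - (turns k c)%:R <= 1.
Proof.
move=> /csum_bounds/andP[c0 ck]; have /andP[lb ub] := truncn_itv c0.
split; first by rewrite -(ler_nat R) (le_trans lb).
by rewrite subr_ge0 lb lerBlDr addrC natr1 ltW.
Qed.

(** Entries that have not wrapped are at least 0, wrapped ones at most 0, and both runs are
    nonincreasing. *)
Lemma extend_le k c i j : in_simplex k c ->
  (i <= j < k + k)%N -> extend k c j <= extend k c i.
Proof.
move=> [cb cd] /andP[ij jk]; rewrite /extend.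
case: (ltnP j k) => jk'; first by rewrite (leq_ltn_trans ij jk') cd.
case: (ltnP i k) => ik; last by rewrite lerD2r cd //; lia.
have /andP[_ c1] := cb (j - k)%N ltac:(lia); have /andP[c0 _] := cb i ik; lra.
Qed.

Lemma in_simplex_descend k c : in_simplex k.+1 c -> in_simplex k (descend k.+1 c).
Proof.
move=> sc; have [rk _] := turns_bounds sc; have [cb cd] := sc.
rewrite /descend /=; set r := turns _ _ in rk *.
split=> [i ik|i j ij jk]; last by rewrite lerD2r extend_le //; lia.
rewrite subr_ge0 extend_le //=; last by lia.
rewrite lerBlDr /extend; case: (ltnP (k + r) k.+1) => kr.
  have /andP[_ u1] := cb (i + r)%N ltac:(lia); have /andP[l0 _] := cb (k + r)%N kr.
  by rewrite ltnW ?ltnS; [lra|lia].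
(* Here r > 0, so the subtracted entry is c (r-1) - 1. An entry that has not wrapped is at most c
   (r-1), and a wrapped one is at most 0. *)
have -> : (k + r - k.+1 = r.-1)%N by lia.
case: (ltnP (i + r) k.+1) => ir.
  by have := cd r.-1 (i + r)%N ltac:(lia) ir; lra.
have /andP[_ u1] := cb (i + r - k.+1)%N ltac:(lia).
by have /andP[l0 _] := cb r.-1 ltac:(lia); lra.
Qed.

(** * One stage in simplex coordinates *)

Lemma Qpoint_Nmx m w c : Qpoint m.+2 w c *m Nmx m.+1 =
  \row_j (Num.sqrt (1 + w) *
    (c j + ncoef m.+1 * csum m.+1 c - c m.+1 / Num.sqrt m.+2%:R)).
Proof.
apply/rowP => j; rewrite !mxE big_ord_recr /= NmxE_last mxE /=.
set t := bcoef _ w * _; set g := Num.sqrt (1 + w).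
(* Each column of N_k sums to zero, so the terms in t, the common summand of all coordinates, cancel
   in the end. *)
transitivity (t + g * c j + ncoef m.+1 * (m.+1%:R * t + g * csum m.+1 c)
   - (t + g * c m.+1) / Num.sqrt m.+2%:R).
  rewrite -mulrN; congr (_ + _).
  transitivity (\sum_(i < m.+1)
    ((i == j)%:R * (t + g * c i) + ncoef m.+1 * (t + g * c i))).
    by apply: eq_bigr => i _; rewrite NmxE mxE -mulrDl mulrC; congr (_ * _).
  rewrite big_split /= -mulr_sumr (bigD1 j) //= eqxx mul1r big1 ?addr0 => [|i /negPf->].
    rewrite big_split /= sumr_const card_ord -mulr_natl -mulr_sumr.
    by rewrite mulr1 mulr_natl.
  by rewrite mul0r.
rewrite /ncoef; have u0 := sqrt_nat_neq0 m.+1; set u := Num.sqrt _ in u0 *.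
by field; rewrite u0 nat1r pnatr_eq0.
Qed.

Lemma lambdaE k : lambda k = Num.sqrt k%:R / Num.sqrt k.+1%:R :> R.
Proof. by rewrite /lambda sqrtrM ?ler0n // sqrtrV ?ler0n. Qed.

(** Scaling by lambda_k turns the difference a - b = sqrt (1 + 1/k) of P_k into 1, so no factor
    accumulates from stage to stage. *)
Lemma lambda_width k : lambda k.+1 * Num.sqrt (1 + k.+1%:R^-1) = 1 :> R.
Proof.
rewrite /lambda -sqrtrM ?divr_ge0 ?ler0n //.
have k0 : k.+1%:R != 0 :> R by rewrite pnatr_eq0.
have k1 : k.+1%:R + 1 != 0 :> R by rewrite natr1 pnatr_eq0.
rewrite -[k.+2%:R]natr1 -[RHS]sqrtr1; congr Num.sqrt.
by move: (k.+1%:R) k0 k1 => K k0 k1; field; rewrite k0 k1.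
Qed.

Lemma hlenE k : hlen k.+1 k.+1%:R^-1 = (Num.sqrt k.+1%:R)^-1 :> R.
Proof.
rewrite /hlen /= -sqrtrV ?ler0n //; congr Num.sqrt.
by rewrite -[k.+1%:R]natr1; field; rewrite natr1 pnatr_eq0.
Qed.

Lemma lambda_bcoef k : lambda k.+1 * bcoef k.+1 k.+1%:R^-1 = ncoef k.+1 :> R.
Proof.
rewrite /bcoef /ncoef mulrA mulrBr lambda_width hlenE lambdaE.
by congr ((_ - _) / _); rewrite mulrAC divff ?mul1r ?sqrt_nat_neq0.
Qed.

(** The length h cancels in s / h, so r depends on c alone. *)
Lemma stage_Qpoint m w c : 0 < hlen m.+2 w -> in_simplex m.+2 c ->
  stage w (Qpoint m.+2 w c) =
    ((Num.sqrt (1 + w) * lambda m.+1) *: Qpoint m.+1 m.+1%:R^-1 (descend m.+2 c),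
     (Num.sqrt m.+2%:R)^-1 * (hlen m.+2 w * (csum m.+2 c - (turns m.+2 c)%:R))).
Proof.
move=> h0 sc; have [rk _] := turns_bounds sc.
rewrite /stage sum_Qpoint mulrAC divff ?lt0r_neq0 // mul1r floor_csum //=.
rewrite iter_phi_inv_Qpoint // sum_Qpoint csum_extend // Qpoint_Nmx; congr pair.
apply/rowP => j; rewrite !mxE -[RHS]mulrA; congr (_ * _).
rewrite mulrDr [lambda _ * (bcoef _ _ * _)]mulrA lambda_bcoef.
rewrite [lambda _ * (_ * descend _ _ _)]mulrA lambda_width mul1r {2}/descend /=.
have -> : csum m.+1 (descend m.+2 c) =
    csum m.+1 (fun i => extend m.+2 c (i + turns m.+2 c)) -
    m.+1%:R * extend m.+2 c (m.+1 + turns m.+2 c).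
  by rewrite /csum sumrB sumr_const card_ord mulr_natl.
(* With d the last rotated coordinate and k = m + 2, the terms in d agree because (k - 1) * [ncoef]
   (k - 1) + 1 = 1 / sqrt k. *)
rewrite /ncoef; move: (csum m.+1 _) => t; move: (extend _ _ (m.+1 + _)) => d.
have u0 := sqrt_nat_neq0 m.+1; set u := Num.sqrt _ in u0 *.
by field; rewrite u0 nat1r pnatr_eq0.
Qed.

(** * The map Theta in simplex coordinates, and its range *)

(* The point of lambda_k P_k with coordinates c. *)
Definition Ppoint k c : 'rV[R]_k := lambda k *: Qpoint k k%:R^-1 c.

Definition frac k c : R := csum k c - (turns k c)%:R.

Lemma Theta_from1 c (i : 'I_1) : Theta_from (Ppoint 1 c) 0 i = c 0%N * pside 1.
Proof.
rewrite ord1 /= !mxE /csum big_ord1 -mulrDl /bcoef hlenE.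
by rewrite lambdaE /pside sqrtr1 mul1n invr1 mulr1 subrK !mul1r mulrC.
Qed.

(** For k = m + 2 the prism has height lambda_k h / sqrt k with h = 1 / sqrt k, which is p_k. *)
Lemma Theta_fromS m c : in_simplex m.+2 c ->
  Theta_from (Ppoint m.+2 c) =
    append_coord (Theta_from (Ppoint m.+1 (descend m.+2 c))) (frac m.+2 c * pside m.+2).
Proof.
move=> sc; have u0 := sqrt_nat_neq0 m.+1; have v0 := sqrt_nat_neq0 m.+2.
have l0 : lambda m.+2 != 0 :> R by rewrite lambdaE mulf_neq0 ?invr_eq0.
have h0 : 0 < hlen m.+2 m.+2%:R^-1 :> R by rewrite hlenE invr_gt0 sqrt_nat_gt0.
transitivity (append_coord
  (Theta_from (lambda m.+2 *: (stage m.+2%:R^-1 (Qpoint m.+2 m.+2%:R^-1 c)).1))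
  (lambda m.+2 * (stage m.+2%:R^-1 (Qpoint m.+2 m.+2%:R^-1 c)).2)).
  have <- : (lambda m.+2)^-1 *: Ppoint m.+2 c = Qpoint m.+2 m.+2%:R^-1 c.
    exact: scalerK.
  by [].
rewrite stage_Qpoint // hlenE /fst /snd scalerA mulrA lambda_width mul1r.
congr append_coord.
rewrite lambdaE /pside sqrtM_nat -/(frac _ _).
by move: (Num.sqrt _) (Num.sqrt _) u0 v0 => u v u0 v0; field; rewrite u0 v0.
Qed.

Lemma hlen0 k : hlen k 0 = 1 :> R.
Proof. by rewrite /hlen mul0r subr0 sqrtr1. Qed.

Lemma Qpoint0 k c : Qpoint k 0 c = \row_i c i.
Proof.
apply/rowP => i; rewrite !mxE /bcoef hlen0 addr0 sqrtr1.
by rewrite subrr mul0r mul0r add0r mul1r.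
Qed.

Lemma ThetaE m c : in_simplex m.+2 c ->
  Theta (\row_(i < m.+2) c i) =
    append_coord (Theta_from (Ppoint m.+1 (descend m.+2 c)))
      (frac m.+2 c / Num.sqrt m.+2%:R).
Proof.
move=> sc; have h0 : 0 < hlen m.+2 0 :> R by rewrite hlen0 ltr01.
transitivity (append_coord (Theta_from (stage 0 (Qpoint m.+2 0 c)).1)
  (stage 0 (Qpoint m.+2 0 c)).2); first by rewrite -Qpoint0.
by rewrite stage_Qpoint // hlen0 /fst /snd addr0 sqrtr1 !mul1r mulrC.
Qed.

(** The initial memory serves as the coordinate sequence of x, so the geometric lemmas apply
    directly to what the program reads. *)
Lemma in_O_in_simplex n (x : 'rV[R]_n) : in_O x -> in_simplex n (mem (input x)).
Proof.
move=> [xb xd]; split=> [i ik|i j ij jk] /=; first by rewrite insubT.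
by rewrite !insubT ?(leq_ltn_trans ij) // => ik; apply: xd.
Qed.

Lemma row_input n (x : 'rV[R]_n) : x = \row_i mem (input x) i.
Proof. by apply/rowP => i; rewrite mxE /= valK. Qed.

Lemma append_coord_last m (u : 'rV[R]_m) a (i : 'I_m.+1) :
  i = m :> nat -> append_coord u a 0 i = a.
Proof.
move=> im; have -> : i = ord_max by apply: val_inj.
by rewrite mxE unlift_none.
Qed.

Lemma append_coord_lt m (u : 'rV[R]_m) a (i : 'I_m.+1) (j : 'I_m) :
  i = j :> nat -> append_coord u a 0 i = u 0 j.
Proof.
move=> ij; have -> : i = lift ord_max j by apply: ord_inj; rewrite lift_max.
by rewrite mxE liftK.
Qed.

Lemma pside_ge0 k : 0 <= pside k :> R.
Proof. by rewrite invr_ge0 sqrtr_ge0. Qed.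

Lemma Theta_from_bounds m c (i : 'I_m.+1) : in_simplex m.+1 c ->
  0 <= Theta_from (Ppoint m.+1 c) 0 i <= pside i.+1.
Proof.
elim: m c i => [|m IH] c i sc.
  have [/(_ 0%N isT)/andP[c0 c1] _] := sc.
  by rewrite Theta_from1 ord1 mulr_ge0 ?pside_ge0 // ler_piMl ?pside_ge0.
rewrite Theta_fromS //; case: (ltnP i m.+1) => im.
  rewrite (@append_coord_lt _ _ _ _ (Ordinal im)) //.
  by rewrite (IH _ (Ordinal im)) //; exact: in_simplex_descend.
have iE : i = m.+1 :> nat by apply/eqP; rewrite eqn_leq im -ltnS ltn_ord.
have [_ /andP[f0 f1]] := turns_bounds sc.
by rewrite append_coord_last // iE mulr_ge0 ?pside_ge0 // ler_piMl ?pside_ge0.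
Qed.

Lemma Theta_in_brick m c : in_simplex m.+2 c -> in_brick (Theta (\row_(i < m.+2) c i)).
Proof.
move=> sc i; rewrite ThetaE // /brick_side eqSS; case: eqP => im.
  have [_ /andP[f0 f1]] := turns_bounds sc.
  rewrite append_coord_last // divr_ge0 ?sqrtr_ge0 //.
  by rewrite ler_piMl ?invr_ge0 ?sqrtr_ge0.
have im1 : (i < m.+1)%N by have := ltn_ord i; lia.
rewrite (@append_coord_lt _ _ _ _ (Ordinal im1)) //.
by apply: (@Theta_from_bounds _ _ (Ordinal im1)); exact: in_simplex_descend.
Qed.

End Geometry.

(** * The program *)

Fixpoint block (l : seq prog) : prog :=
  if l is p :: l' then Seq p (block l') else Skip.

(* Register 0 holds n, 1 holds 1, 2 holds k, 3 the squared denominator of y_k.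
   Cells n, ..., n+k-1 hold the coordinates c of z^(k)
   (of x when k = n); y_(k+1), ..., y_n are already in their final cells. *)
Definition extend_loop : prog :=
  WhileLt 4 2 (block [:: Add 5 0 4; Fetch 6 5; Add 7 7 6; Sub 6 6 1;
                         Add 5 10 4; Put 5 6; Add 4 4 1]).

Definition shift_loop : prog :=
  WhileLt 4 2 (block [:: Add 5 10 4; Fetch 6 5; Sub 6 6 9; Add 5 0 4;
                         Put 5 6; Add 4 4 1]).

(** Register 8 receives r and register 7 the remainder, which is divided before register 3 advances
    to k^2 - k = (k-1)k for the next coordinate. By the time y_k is stored, register 2 has dropped
    to k - 1, the 0-based address of y_k. *)
Definition stage_prog : prog :=
  block [:: Const 4 0; Const 7 0; Add 10 0 2; extend_loop;
            Floor 8 7; Sub 7 7 8; Sqrt 6 3; Div 7 7 6;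
            Mul 3 2 2; Sub 3 3 2; Sub 2 2 1; Put 2 7;
            Add 10 0 8; Add 5 10 2; Fetch 9 5; Const 4 0; shift_loop].

Definition copy_loop : prog :=
  WhileLt 4 0 (block [:: Fetch 6 4; Add 5 0 4; Put 5 6; Add 4 4 1]).

Definition stages_prog : prog :=
  block [:: WhileLt 1 2 stage_prog;
            Const 4 0; Fetch 6 0; Sqrt 7 3; Div 6 6 7; Put 4 6].

(** Register 3 starts as n because the last side of the brick is 1 / sqrt n rather than p_n. Working
    on a copy from cell n on frees the cells below n for the results. *)
Definition Theta_prog : prog :=
  block [:: Const 1 1; Copy 2 0; Copy 3 0; Const 4 0; copy_loop; stages_prog].

Arguments block : simpl never.
Arguments upd {R} f i v j /.

(** * Rules for execution with a time bound *)

Section Program.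
Variable R : realType.
Implicit Types (p q : prog) (s : state R) (c : nat -> R).

(** A Hoare triple for total correctness, with an upper bound on the number of steps. *)
Definition runs p s T (Q : state R -> Prop) : Prop :=
  exists t s', [/\ exec p s t s', (t <= T)%N & Q s'].

Lemma runs_weaken p s T U (P Q : state R -> Prop) : runs p s T P -> (T <= U)%N ->
  (forall s', P s' -> Q s') -> runs p s U Q.
Proof.
move=> [t [s' [e tT Ps]]] TU PQ; exists t, s'; split=> //; last exact: PQ.
exact: leq_trans TU.
Qed.

Lemma runs_nil s (Q : state R -> Prop) : Q s -> runs (block [::]) s 0 Q.
Proof. by move=> Qs; exists 0%N, s; split=> //; constructor. Qed.

Lemma runs_seq p q s T U (P Q : state R -> Prop) : runs p s T P ->
  (forall s', P s' -> runs q s' U Q) -> runs (Seq p q) s (T + U) Q.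
Proof.
move=> [t [s' [e tT Ps]]] /(_ _ Ps)[u [s2 [e2 uU Qs]]].
by exists (t + u)%N, s2; split=> //; [apply: exec_seq e e2 | exact: leq_add].
Qed.

Lemma runs_cons p l s s1 T (Q : state R -> Prop) : exec p s 1 s1 ->
  runs (block l) s1 T Q -> runs (block (p :: l)) s T.+1 Q.
Proof.
move=> e r; rewrite -[T.+1]add1n; apply: (@runs_seq _ _ _ _ _ (eq s1)).
  by exists 1%N, s1.
by move=> _ <-.
Qed.

Lemma runs_fetch d a i l s T (Q : state R -> Prop) : reg s a = i%:R ->
  runs (block l) (set_reg s d (mem s i)) T Q -> runs (block (Fetch d a :: l)) s T.+1 Q.
Proof. by move=> ai; apply: runs_cons; apply: exec_fetch. Qed.

Lemma runs_put a b i l s T (Q : state R -> Prop) : reg s a = i%:R ->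
  runs (block l) (set_mem s i (reg s b)) T Q -> runs (block (Put a b :: l)) s T.+1 Q.
Proof. by move=> ai; apply: runs_cons; apply: exec_put. Qed.

Ltac step :=
  first [ apply: (runs_cons (exec_const _ _ _)) | apply: (runs_cons (exec_copy _ _ _))
        | apply: (runs_cons (exec_add _ _ _ _)) | apply: (runs_cons (exec_sub _ _ _ _))
        | apply: (runs_cons (exec_mul _ _ _ _))
        | apply: (runs_cons (exec_floor _ _ _)) ];
  rewrite /=.

Lemma runs_block p l s T U (P Q : state R -> Prop) : runs p s T P ->
  (forall s', P s' -> runs (block l) s' U Q) -> runs (block (p :: l)) s (T + U) Q.
Proof. exact: runs_seq. Qed.

(** The continuation [q] is kept attached, so that an induction can treat a loop together with the
    code after it, as [runs_stages] does. *)
Lemma runs_while_step a b p q s T U (P Q : state R -> Prop) : reg s a < reg s b ->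
  runs p s T P -> (forall s', P s' -> runs (Seq (WhileLt a b p) q) s' U Q) ->
  runs (Seq (WhileLt a b p) q) s (T + U).+1 Q.
Proof.
move=> ab [t [s' [e tT Ps]]] /(_ _ Ps)[u [s2 [e2 uU Qs]]].
inversion e2 as [|? ? ? t1 s1 t2 ? e3 e4| | | | | | | | | | | | | |]; subst.
exists ((t + t1).+1 + t2)%N, s2; split=> //; last by lia.
by apply: exec_seq e4; apply: exec_while_true e3.
Qed.

(** Each pass costs one comparison besides its body, and one failing comparison ends the loop. *)
Lemma runs_for a b p (I : nat -> state R -> Prop) N T s :
  (forall j s', I j s' -> reg s' a = j%:R /\ reg s' b = N%:R) ->
  (forall j s', (j < N)%N -> I j s' -> runs p s' T (I j.+1)) ->
  I 0%N s -> runs (WhileLt a b p) s (N * T.+1).+1 (I N).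
Proof.
move=> Iab step; rewrite -[X in (X * _)%N]subn0.
suff loop d j s' : (d = N - j)%N -> (j <= N)%N -> I j s' ->
    runs (WhileLt a b p) s' (d * T.+1).+1 (I N) by exact: loop.
elim: d j s' => [|d IH] j s' dN jN Ij; have [ja bN] := Iab _ _ Ij.
  have jE : j = N by lia.
  exists 1%N, s'; split; rewrite -?jE //.
  by apply: exec_while_false; rewrite ja bN jE ltxx.
have ltj : (j < N)%N by lia.
have [t [s1 [e tT I1]]] := step _ _ ltj Ij.
have [u [s2 [e2 uU I2]]] := IH j.+1 s1 ltac:(lia) ltj I1.
exists (t + u).+1, s2; split=> //; last by rewrite mulSn; lia.
by apply: exec_while_true e e2; rewrite ja bN ltr_nat.
Qed.

(** * Correctness and cost of the program *)

Definition header n k D s : Prop :=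
  [/\ reg s 0%N = n%:R, reg s 1%N = 1, reg s 2%N = k%:R & reg s 3%N = D%:R].

(** Writing the wrapped entries out in memory turns the rotation by r into a mere offset of
    addresses, without modular arithmetic. *)
Lemma runs_extend n k D c s :
  header n k D s -> reg s 4%N = 0 -> reg s 7%N = 0 -> reg s 10%N = (n + k)%:R ->
  (forall j, (j < k)%N -> mem s (n + j) = c j) ->
  runs extend_loop s (k * 8).+1 (fun s' =>
    [/\ header n k D s', reg s' 7%N = csum k c, reg s' 10%N = (n + k)%:R,
        forall j, (j < k + k)%N -> mem s' (n + j) = extend k c j &
        forall j, (j < n)%N -> mem s' j = mem s j]).
Proof.
move=> hs s4 s7 s10 sm.
pose I i s' := [/\ header n k D s' /\ reg s' 10%N = (n + k)%:R, reg s' 4%N = i%:R,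
  reg s' 7%N = csum i c,
  forall j, (j < k + i)%N -> mem s' (n + j) = extend k c j &
  forall j, (j < n)%N -> mem s' j = mem s j].
apply: (@runs_weaken _ _ (k * 8).+1 _ (I k)) => // [|s' [[h r10] _ r7 mE fE]]; last by split.
apply: runs_for => [j s' [[[]]] //|i s' ik [[[r0 r1 r2 r3] r10] r4 r7 mE fE]|]; last first.
  split=> //; rewrite ?/csum ?big_ord0 // => j; rewrite addn0 => jk.
  by rewrite sm // /extend jk.
step; apply: (@runs_fetch _ _ (n + i)) => /=; first by rewrite r0 r4 -natrD.
do 3!step.
apply: (@runs_put _ _ (n + k + i)) => /=; first by rewrite r10 r4 -natrD.
step; apply: runs_nil; rewrite /I /header /= r1 r4 r7 natr1.
split=> // [|j jk|j jn].
- by rewrite /csum big_ord_recr /= mE /extend ?ik //; lia.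
- rewrite -addnA eqn_add2l; case: eqP => [->|ne]; last by apply: mE; lia.
  by rewrite mE /extend ?ik ?ifN; [congr (c _ - 1); lia|lia|lia].
- by rewrite ifN ?fE //; lia.
Qed.

(** The shift can be done in place: pass i writes cell n + i, while later passes read only beyond
    it, and the entry to subtract was saved in register 9. *)
Lemma runs_shift n k D e r s : header n k D s ->
  reg s 4%N = 0 -> reg s 9%N = e (k + r)%N -> reg s 10%N = (n + r)%:R ->
  (forall j, (j <= k + r)%N -> mem s (n + j) = e j) ->
  runs shift_loop s (k * 7).+1 (fun s' =>
    [/\ header n k D s',
        forall j, (j < k)%N -> mem s' (n + j) = e (j + r)%N - e (k + r)%N &
        forall j, (j < n)%N -> mem s' j = mem s j]).
Proof.
move=> hs s4 s9 s10 sm.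
pose I i s' := [/\ header n k D s' /\ reg s' 10%N = (n + r)%:R,
  reg s' 4%N = i%:R /\ reg s' 9%N = e (k + r)%N,
  forall j, (j < i)%N -> mem s' (n + j) = e (j + r)%N - e (k + r)%N,
  forall j, (i <= j <= k + r)%N -> mem s' (n + j) = e j &
  forall j, (j < n)%N -> mem s' j = mem s j].
apply: (@runs_weaken _ _ (k * 7).+1 _ (I k)) => // [|s' [[h _] _ mE _ fE]]; last by split.
apply: runs_for => [j s' [[[]]] //|i s' ik [[[r0 r1 r2 r3] r10] [r4 r9] mE eE fE]|].
- by move=> ? ? ? ? ? [].
- step; apply: (@runs_fetch _ _ (n + (i + r))) => /=.
    by rewrite r10 r4 -natrD; congr _%:R; lia.
  do 2!step; apply: (@runs_put _ _ (n + i)) => /=; first by rewrite r0 r4 -natrD.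
  step; apply: runs_nil; rewrite /I /header /= r1 r4 r9 natr1.
  split=> // [j ji|j ji|j jn].
  + rewrite eqn_add2l; case: eqP => [->|ne]; last by apply: mE; lia.
    by rewrite eE //; lia.
  + by rewrite eqn_add2l ifN ?eE //; lia.
  + by rewrite ifN ?fE //; lia.
- by split=> // j /andP[_]; apply: sm.
Qed.

Lemma runs_stage n k D c s : (k < n)%N -> (0 < D)%N -> in_simplex k.+1 c ->
  header n k.+1 D s -> (forall j, (j <= k)%N -> mem s (n + j) = c j) ->
  runs stage_prog s (15 * k + 30) (fun s' =>
    [/\ header n k (k * k.+1) s', mem s' k = frac k.+1 c / Num.sqrt D%:R,
        forall j, (j < k)%N -> mem s' (n + j) = descend k.+1 c j &
        forall j, (j < n)%N -> j != k -> mem s' j = mem s j]).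
Proof.
move=> kn D0 sc hs sm; have [rk _] := turns_bounds sc; have [s0 s1 s2 s3] := hs.
have kE : k.+1%:R - 1 = k%:R :> R by rewrite -natr1 addrK.
have D0' : (0 : R) < D%:R by rewrite ltr0n.
(* Three instructions precede the first loop and twelve separate it from the second; the total is
   15k + 25. *)
set T := (((k.+1 * 8).+1 + ((k * 7).+1 + 0).+4.+4.+4).+3)%N.
apply: (@runs_weaken _ _ T) => [||s' Ps]; [|by rewrite /T; lia|exact: Ps].
do 3!step; apply: (runs_block (@runs_extend n k.+1 D c _ _ _ _ _ _)) => //=.
  by rewrite s0 s2 natrD.
move=> t [[t0 t1 t2 t3] t7 t10 tm tf].
do 2!step; apply: (runs_cons (exec_sqrt _ _)) => /=; first by rewrite t3 ler0n.
apply: (runs_cons (exec_div _ _ _)) => /=; first by rewrite t3 gt_eqF ?sqrtr_gt0.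
do 3!step; apply: (@runs_put _ _ k) => /=; first by rewrite t2 t1.
do 2!step.
apply: (@runs_fetch _ _ (n + (k + turns k.+1 c))) => /=.
  rewrite t0 t1 t2 t7 kE floor_csum // -!natrD; congr _%:R; lia.
step; apply: (runs_block (@runs_shift n k (k * k.+1) (extend k.+1 c)
  (turns k.+1 c) _ _ _ _ _ _)).
- rewrite /header /= t0 t1 t2 kE; split=> //.
  by rewrite -natrM -natrB ?leq_pmulr // mulSn addKn.
- by [].
- by rewrite /= ifN ?tm //; lia.
- by rewrite /= t0 t7 floor_csum // -natrD.
- by move=> j jk /=; rewrite ifN ?tm //; lia.
move=> u [hu um uf]; apply: runs_nil; split=> //.
  by rewrite uf //= eqxx t7 t3 floor_csum.
by move=> j jn jk; rewrite uf //= (negPf jk) tf.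
Qed.

(** Each of the m passes costs at most 15n + 30 steps and a comparison; 10 covers the last
    comparison and the code for y_1. A stored coordinate survives because later stages write results
    only to lower cells. *)
Lemma runs_stages n m c s (Q : state R -> Prop) : (m < n)%N -> in_simplex m.+1 c ->
  header n m.+1 (m.+1 * m.+2) s -> (forall j, (j <= m)%N -> mem s (n + j) = c j) ->
  (forall s', (forall j, (j < n)%N -> (m < j)%N -> mem s' j = mem s j) ->
    (forall i : 'I_m.+1, mem s' i = Theta_from (Ppoint m.+1 c) 0 i) -> Q s') ->
  runs stages_prog s (m * (15 * n + 31) + 10) Q.
Proof.
elim: m c s Q => [|m IH] c s Q mn sc hs sm sQ.
  have [s0 s1 s2 s3] := hs; rewrite mul0n add0n.
  apply: (@runs_weaken _ _ (1 + 5) _ Q) => //.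
  apply: (@runs_block _ _ _ 1 5 (eq s)) => [|_ <-].
    exists 1%N, s; split=> //; apply: exec_while_false; by rewrite s1 s2 ltxx.
  step; apply: (@runs_fetch _ _ n) => //=.
  apply: (runs_cons (exec_sqrt _ _)) => /=; first by rewrite s3 ler0n.
  apply: (runs_cons (exec_div _ _ _)) => /=.
    by rewrite s3 gt_eqF ?sqrtr_gt0 ?ltr0n.
  apply: (@runs_put _ _ 0) => //=; apply: runs_nil; apply: sQ => [j jn j0|i] /=.
    by rewrite gtn_eqF.
  by rewrite Theta_from1 ord1 /= -[n]addn0 sm // s3.
have [s0 s1 s2 s3] := hs.
apply: (@runs_weaken _ _ (15 * m.+1 + 30 + (m * (15 * n + 31) + 10)).+1 _ Q) => //;
  last by rewrite mulSn; nia.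
apply: (runs_while_step _ (runs_stage mn _ sc hs sm)) => // [|s' [hs' yE nE fE]].
  by rewrite s1 s2 ltr1n.
apply: (IH (descend m.+2 c)) hs' nE _ => //; [exact: ltnW|exact: in_simplex_descend|].
move=> t tf tE; apply: sQ => [j jn mj|i].
  by rewrite tf ?fE ?(ltnW mj) // gtn_eqF.
rewrite Theta_fromS //; case: (ltnP i m.+1) => im.
  by rewrite (append_coord_lt _ _ (j := Ordinal im)) // -tE.
have iE : i = m.+1 :> nat by apply/eqP; rewrite eqn_leq im -ltnS ltn_ord.
by rewrite append_coord_last // iE tf ?iE // yE.
Qed.

Lemma runs_copy n c s : reg s 0%N = n%:R -> reg s 4%N = 0 -> reg s 1%N = 1 ->
  (forall j, (j < n)%N -> mem s j = c j) ->
  reg s 2%N = n%:R -> reg s 3%N = n%:R ->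
  runs copy_loop s (n * 5).+1 (fun s' =>
    header n n n s' /\ forall j, (j < n)%N -> mem s' (n + j) = c j).
Proof.
move=> s0 s4 s1 sm s2 s3.
pose I i s' := [/\ header n n n s', reg s' 4%N = i%:R,
  forall j, (j < i)%N -> mem s' (n + j) = c j &
  forall j, (j < n)%N -> mem s' j = c j].
apply: (@runs_weaken _ _ (n * 5).+1 _ (I n)) => // [|s' [? _ ? _]]; last by split.
apply: runs_for => [j s' [[]] //|i s' ik [[r0 r1 r2 r3] r4 mE fE]|]; last by split.
apply: (@runs_fetch _ _ i) => //=; step.
apply: (@runs_put _ _ (n + i)) => /=; first by rewrite r0 r4 -natrD.
step; apply: runs_nil; rewrite /I /header /= r1 r4 natr1.
split=> // [j ji|j jn].
- by rewrite eqn_add2l; case: eqP => [->|ne]; [exact: fE|apply: mE; lia].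
- by rewrite ifN ?fE //; lia.
Qed.

Lemma runs_Theta_prog m (x : 'rV[R]_m.+2) : in_O x ->
  runs Theta_prog (input x) (90 * m.+2 ^ 2)
    (fun s => forall i : 'I_m.+2, mem s i = Theta x 0 i).
Proof.
move=> /in_O_in_simplex sc; set c := mem (input x) in sc.
have -> : Theta x = Theta (\row_j c j) by congr Theta; exact: row_input.
rewrite ThetaE //.
(* With n = m + 2 this is 15n^2 + 21n - 31, well below the claimed bound. *)
set T := ((m.+2 * 5).+1 + ((15 * m.+1 + 30 + (m * (15 * m.+2 + 31) + 10)).+1 + 0)).+4%N.
apply: (@runs_weaken _ _ T) => [||s Ps]; [|by rewrite /T; nia|exact: Ps].
do 4!step; apply: (runs_block (@runs_copy m.+2 c _ _ _ _ _ _ _)) => //= s [hs sm].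
have [s0 s1 s2 s3] := hs; apply: runs_block; last by move=> s'; exact: runs_nil.
(* The first pass is split off, since its squared denominator n is not of the form k(k+1) with k = n
   that [runs_stages] expects. *)
apply: (runs_while_step _ (runs_stage (ltnSn _) _ sc hs sm)) => //.
  by rewrite s1 s2 ltr1n.
move=> s' [hs' yE nE _].
apply: (runs_stages (c := descend m.+2 c)) hs' nE _ => //.
  exact: in_simplex_descend.
move=> t tf tE i.
case: (ltnP i m.+1) => im.
  by rewrite (append_coord_lt _ _ (j := Ordinal im)) // -tE.
have iE : i = m.+1 :> nat by apply/eqP; rewrite eqn_leq im -ltnS ltn_ord.
by rewrite append_coord_last // iE tf ?iE // yE.
Qed.

End Program.

Theorem theorem3 (R : realType) :
  exists (p : prog) (C : nat),
    forall (n : nat) (x : 'rV[R]_n), (2 <= n)%N -> in_O x ->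
      in_brick (Theta x) /\ computes_within p x (Theta x) (C * n ^ 2).
Proof.
exists Theta_prog, 90%N => -[|[|m]] // x _ xO; split; last exact: runs_Theta_prog.
by rewrite [x]row_input; apply: Theta_in_brick; exact: in_O_in_simplex.
Qed.
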